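(* Let $\beta,\beta_1$ be elements of a commutative ring (e.g. independent indeterminates), and set $t=\beta+\beta_1$, $n=\beta\beta_1$. For a positive integer $m$ let $\Psi_{m,\beta}(x)=\frac{x^m-\beta^m}{x-\beta}=\sum_{i=0}^{m-1}\beta^{m-1-i}x^i$, similarly $\Psi_{m,\beta_1}(x)$, let $p_m(x)=\Psi_{m,\beta}(x)\Psi_{m,\beta_1}(x)$, and let $a_m$ be the coefficient of $x^{m-1}$ in $p_m(x)$. Then $a_1=1$, $a_2=t$, and $a_{m+2}=ta_{m+1}-na_m$ for all $m\ge1$; moreover, for every $m\ge1$, $$p_m(x)=\sum_{i=1}^{m-1}a_ix^{2m-1-i}+a_mx^{m-1}+\sum_{i=1}^{m-1}a_{m-i}n^ix^{m-1-i},$$ where the two outer sums are interpreted as $0$ when $m=1$. *)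

(* Defs.v *)
From mathcomp Require Import all_boot all_order all_algebra.
Set Implicit Arguments.
Unset Strict Implicit.
Unset Printing Implicit Defensive.
Import GRing.Theory.
Local Open Scope ring_scope.

Definition Psi (R : comNzRingType) (m : nat) (b : R) : {poly R} :=
  \sum_(i < m) b ^+ (m - 1 - i) *: 'X^i.

(* The division by 'X - b%:P is meaningful over any commutative ring: the
   divisor is monic, hence regular, so this equation characterizes Psi m b. *)
Lemma Psi_quotient (R : comNzRingType) (m : nat) (b : R) (q : {poly R}) :
  q * ('X - b%:P) = 'X^m - (b ^+ m)%:P <-> q = Psi m b.
Proof.
have H : Psi m b * ('X - b%:P) = 'X^m - (b ^+ m)%:P.
  rewrite polyC_exp -[RHS]opprB subrXX -[RHS]mulNr opprB mulrC.
  congr (_ * _); apply: eq_bigr => i _.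
  by rewrite -mul_polyC polyC_exp subn1.
split=> [|->//]; rewrite -H => E.
by apply: (monic_rreg (monicXsubC b)).
Qed.

Definition pprod (R : comNzRingType) (beta beta1 : R) (m : nat) : {poly R} :=
  Psi m beta * Psi m beta1.

Definition midcoef (R : comNzRingType) (beta beta1 : R) (m : nat) : R :=
  (pprod beta beta1 m)`_(m - 1).

(* Main.v *)
(** Writing [a_m] as [h_m], the complete homogeneous sum of degree [m - 1] in
    [b] and [c], one has [h_(m+2) = b^(m+1) + c^(m+1) + b c h_m].  With
    [H_m = h_1 X^(m-1) + ... + h_m], this lifts to
    [H_(m+2) = X^(m+1) + b Psi_(m+1,b) + c Psi_(m+1,c) + b c H_m].  Expanding
    [p_(m+1) = (X^m + b Psi_(m,b)) (X^m + c Psi_(m,c))] and using this identity,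
    [p_m - X^(m-1) H_m] satisfies the recursion [L_(m+1) = b c (L_m + h_m X^(m-1))]
    that defines the lower half of the expansion. *)
Require Import Defs.
From mathcomp Require Import all_boot all_order all_algebra.
From mathcomp Require Import ring.
Set Implicit Arguments.
Unset Strict Implicit.
Unset Printing Implicit Defensive.
Import GRing.Theory.
Local Open Scope ring_scope.

Section ProductOfQuotients.

Variable R : comNzRingType.
Implicit Types (b c : R) (m : nat).

Lemma Psi_recl m b : Psi m.+1 b = 'X * Psi m b + (b ^+ m)%:P.
Proof.
rewrite /Psi big_ord_recl /= expr0 subn0 subn1 /= alg_polyC addrC.
congr (_ + _); rewrite mulr_sumr; apply: eq_bigr => i _.
by rewrite -scalerAr -exprS -subnDA.
Qed.

Lemma Psi_recr m b : Psi m.+1 b = 'X^m + b%:P * Psi m b.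
Proof.
rewrite /Psi big_ord_recr /= subn1 /= subnn expr0 scale1r addrC.
congr (_ + _); rewrite mulr_sumr; apply: eq_bigr => i _.
rewrite mul_polyC scalerA -exprS; congr (b ^+ _ *: _).
by rewrite -subnDA add1n subnSK.
Qed.

Lemma coef_Psi m b i : (Psi m b)`_i = if (i < m)%N then b ^+ (m - 1 - i) else 0.
Proof. by rewrite /Psi -(poly_def m (fun i => b ^+ (m - 1 - i))) coef_poly. Qed.

(** The index counts summands, so [hsum2 b c 0] is 0 and the recurrences below already hold at
    [m = 0]. *)
Definition hsum2 b c m : R := \sum_(i < m) b ^+ (m - 1 - i) * c ^+ i.

Lemma hsum2_recr b c m : hsum2 b c m.+1 = b * hsum2 b c m + c ^+ m.
Proof.
rewrite /hsum2 big_ord_recr /= subn1 /= subnn mul1r; congr (_ + _).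
rewrite mulr_sumr; apply: eq_bigr => i _; rewrite mulrA -exprS.
congr (b ^+ _ * _).
by rewrite -subnDA add1n subnSK.
Qed.

Lemma hsum2_recl b c m : hsum2 b c m.+1 = c * hsum2 b c m + b ^+ m.
Proof.
elim: m => [|m IHm]; first by rewrite /hsum2 big_ord1 big_ord0 mulr0 add0r mul1r.
by rewrite hsum2_recr {1}IHm [in RHS]hsum2_recr !exprS; ring.
Qed.

(** Split off both end summands; every remaining one contains the factor [b * c]. *)
Lemma hsum2_pow b c m :
  hsum2 b c m.+2 = b ^+ m.+1 + c ^+ m.+1 + b * c * hsum2 b c m.
Proof. by rewrite hsum2_recr hsum2_recl !exprS; ring. Qed.

(** Two consecutive instances of [hsum2_recr] eliminate the power of [c]. *)
Lemma hsum2_rec b c m :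
  hsum2 b c m.+2 = (b + c) * hsum2 b c m.+1 - b * c * hsum2 b c m.
Proof. by rewrite hsum2_recr [hsum2 b c m.+1]hsum2_recr exprS; ring. Qed.

Lemma midcoefE b c m : midcoef b c m = hsum2 b c m.
Proof.
rewrite /midcoef /pprod /hsum2 coefM; case: m => [|m].
  (* At [m = 0] the index [m - 1] truncates to 0, and both sides vanish. *)
  by rewrite big_ord1 coef_Psi mul0r big_ord0.
rewrite subn1 /=; apply: eq_bigr => i _.
by rewrite !coef_Psi ltn_ord ltnS leq_subr subn1 /= subKn // -ltnS.
Qed.

Definition hpoly2 b c m : {poly R} := \sum_(i < m) hsum2 b c i.+1 *: 'X^(m - 1 - i).

Lemma hpoly2_rec b c m :
  hpoly2 b c m.+1 = 'X * hpoly2 b c m + (hsum2 b c m.+1)%:P.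
Proof.
rewrite /hpoly2 big_ord_recr /= subn1 /= subnn expr0 alg_polyC; congr (_ + _).
rewrite mulr_sumr; apply: eq_bigr => i _; rewrite -scalerAr -exprS.
congr (_ *: 'X^_).
by rewrite -subnDA add1n subnSK.
Qed.

Lemma hpoly2_Psi b c m :
  hpoly2 b c m.+2 =
  'X^(m.+1) + b%:P * Psi m.+1 b + c%:P * Psi m.+1 c + (b * c)%:P * hpoly2 b c m.
Proof.
elim: m => [|m IHm].
  rewrite !hpoly2_rec hsum2_pow !Psi_recr /Psi /hpoly2 /hsum2 !big_ord0 big_ord1.
  by rewrite !rmorphD !expr1 !mulr0 !mul1r; ring.
(* Raising [m] multiplies each term by ['X] and, except for the leading power, adds a constant;
   these constants balance by [hsum2_pow]. *)
rewrite hpoly2_rec IHm hsum2_pow [hpoly2 b c m.+1]hpoly2_rec.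
rewrite [Psi m.+2 b]Psi_recl [Psi m.+2 c]Psi_recl.
by rewrite !exprS !rmorphD !rmorphM /=; ring.
Qed.

Definition lowpart b c m : {poly R} :=
  \sum_(1 <= i < m) (hsum2 b c (m - i) * (b * c) ^+ i) *: 'X^(m - 1 - i).

Lemma lowpart_rec b c m :
  lowpart b c m.+2 =
  (b * c)%:P * (lowpart b c m.+1 + hsum2 b c m.+1 *: 'X^m).
Proof.
(* The summand [i = 1] yields the new term in ['X^m]; the others, shifted by one, each release a
   factor [b * c]. *)
rewrite /lowpart big_nat_recl // expr1 !subn1 /= addrC mulrDr; congr (_ + _).
  rewrite mulr_sumr; apply: eq_bigr => i _.
  by rewrite mul_polyC scalerA exprS mulrCA !subSS.
by rewrite mul_polyC scalerA mulrC.
Qed.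

Lemma pprod_hpoly2 b c m :
  pprod b c m.+1 = 'X^m * hpoly2 b c m.+1 + lowpart b c m.+1.
Proof.
elim: m => [|m IHm].
  rewrite /pprod !Psi_recr hpoly2_rec /Psi /hpoly2 /lowpart /hsum2 !big_ord0.
  by rewrite big_ord1 big_geq // !mulr0 !mul1r !addr0 add0r mulr1.
have E : pprod b c m.+2 = 'X^(m.+1) * 'X^(m.+1)
    + 'X^(m.+1) * (b%:P * Psi m.+1 b + c%:P * Psi m.+1 c) + (b * c)%:P * pprod b c m.+1.
  by rewrite /pprod [Psi m.+2 b]Psi_recr [Psi m.+2 c]Psi_recr rmorphM /=; ring.
(* Since H_(m+1) = X H_m + h_(m+1), the product b c X^m H_(m+1) splits into the last term of X^(m+1)
   H_(m+2) and b c h_(m+1) X^m, which goes to the lower part. *)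
rewrite E IHm lowpart_rec hpoly2_Psi [hpoly2 b c m.+1]hpoly2_rec -mul_polyC.
by rewrite exprS; ring.
Qed.

(** The constant term of [hpoly2 b c m.+1] becomes the middle term of the expansion. *)
Lemma mulXn_hpoly2 b c m :
  'X^m * hpoly2 b c m.+1 =
  \sum_(1 <= i < m.+1) hsum2 b c i *: 'X^(2 * m.+1 - 1 - i) + hsum2 b c m.+1 *: 'X^m.
Proof.
rewrite /hpoly2 big_ord_recr /= subn1 /= subnn expr0 mulrDr -scalerAr mulr1.
congr (_ + _); rewrite big_add1 /= big_mkord mulr_sumr; apply: eq_bigr => i _.
rewrite -scalerAr -exprD; congr (_ *: 'X^_).
(* After the shift of [i], both exponents equal 2m - i. *)
rewrite addnBA ?(ltnW (ltn_ord i)) // mulSn mul1n subn1 addSn /=.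
by rewrite addnS subSS.
Qed.

End ProductOfQuotients.

Theorem theorem3p2 (R : comNzRingType) (beta beta1 : R) :
  let t := beta + beta1 in
  let n := beta * beta1 in
  let p := pprod beta beta1 in
  let a := midcoef beta beta1 in
  [/\ a 1%N = 1,
      a 2%N = t,
      forall m : nat, (1 <= m)%N -> a m.+2 = t * a m.+1 - n * a m
    & forall m : nat, (1 <= m)%N ->
        p m = \sum_(1 <= i < m) a i *: 'X^(2 * m - 1 - i)
              + a m *: 'X^(m - 1)
              + \sum_(1 <= i < m) (a (m - i)%N * n ^+ i) *: 'X^(m - 1 - i)].
Proof.
move=> t n p a; have aE m : a m = hsum2 beta beta1 m by exact: midcoefE.
split=> [||m _|[//|m] _].
- by rewrite aE /hsum2 big_ord1 mul1r.
- by rewrite aE hsum2_pow /hsum2 big_ord0 mulr0 addr0 !expr1.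
- by rewrite !aE hsum2_rec.
rewrite /p pprod_hpoly2 mulXn_hpoly2 aE (subn1 m.+1) /=; congr (_ + _ + _).
  by apply: eq_bigr => i _; rewrite aE.
by rewrite /lowpart (subn1 m.+1); apply: eq_bigr => i _; rewrite aE.
Qed.
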